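(* Let $W\in\mathbb{R}^{n\times m}$ be the weight matrix of a gauged unbiased RBM with ground state energy $E_0$, and let $\gamma$ be the learning rate of one mode-informed update, i.e. $W_{ij}\mapsto W_{ij}-\gamma$ for all $i,j$. If $0<\gamma<-\frac{2E_0}{nm}$, then the variance $\mathrm{Var}_{\mathbf{s}}(E(\mathbf{s}))$ of the energies over all spin states $\mathbf{s}=\{\mathbf{v},\mathbf{h}\}\in\{-1,1\}^n\times\{-1,1\}^m$ (taken with respect to the uniform distribution on spin states) decreases under the update, i.e. it is strictly smaller after the update than before it. The largest decrease in this variance (as a function of $\gamma$) occurs when $\gamma=-\frac{E_0}{nm}$.
   Context: An $n\times m$ unbiased RBM ($n,m\ge 1$) with weight matrix $W\in\mathbb{R}^{n\times m}$ has states (spin states) $\mathbf{s}=\{\mathbf{v},\mathbf{h}\}$ with $\mathbf{v}\in\{-1,1\}^n$, $\mathbf{h}\in\{-1,1\}^m$, and energy $E(\mathbf{s})=E(\mathbf{v},\mathbf{h})=-\sum_{i,j}W_{ij}v_ih_j$. A ground state $\{\mathbf{v}^*,\mathbf{h}^*\}$ is a minimizer of $E$ over all spin states (if there are several, one is selected), and the ground state energy is $E_0=E(\mathbf{v}^*,\mathbf{h}^* )$. The RBM is called gauged if its (selected) ground state is the all-$(+1)$ configuration; any RBM can be gauged by replacing $W_{ij}$ with $W_{ij}v_i^*h_j^*$. Thus for a gauged RBM $E_0=-\sum_{i,j}W_{ij}$. A mode-informed update with learning rate $\gamma$ changes the weights by $\delta W_{ij}=-\gamma v_i^*h_j^*$,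 which equals $-\gamma$ for a gauged RBM. *)

(* Defs.v *)
From mathcomp Require Import all_boot all_order all_algebra.
From mathcomp Require Import reals.

Set Implicit Arguments.
Unset Strict Implicit.
Unset Printing Implicit Defensive.

Import Order.TTheory GRing.Theory Num.Theory.
Local Open Scope ring_scope.

(* A spin in {-1, 1} is encoded by a bool b through its value (-1) ^+ b, so
   [false] is the spin +1 and [true] is the spin -1. *)
Definition spin {R : realType} (b : bool) : R := (-1) ^+ b.

(* The pair (v, h) of visible and hidden spins. *)
Definition spin_state (n m : nat) : Type :=
  ({ffun 'I_n -> bool} * {ffun 'I_m -> bool})%type.

Definition all_plus {n m : nat} : spin_state n m :=
  ([ffun=> false], [ffun=> false]).

Definition energy {R : realType} {n m : nat} (W : 'M[R]_(n, m))
    (s : spin_state n m) : R :=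
  - \sum_(i < n) \sum_(j < m) W i j * spin (s.1 i) * spin (s.2 j).

Definition ground_state {R : realType} {n m : nat} (W : 'M[R]_(n, m))
    (s : spin_state n m) : Prop :=
  forall t : spin_state n m, energy W s <= energy W t.

(* Ground states need not be unique: [s] is the one that has been selected. *)
Definition gauged {R : realType} {n m : nat} (W : 'M[R]_(n, m))
    (s : spin_state n m) : Prop :=
  ground_state W s /\ s = all_plus.

(* [s] is the selected ground state of [W]; when [s] is [all_plus] every weight
   is shifted by - gamma. *)
Definition mode_update {R : realType} {n m : nat} (W : 'M[R]_(n, m))
    (s : spin_state n m) (gamma : R) : 'M[R]_(n, m) :=
  \matrix_(i, j) (W i j - gamma * spin (s.1 i) * spin (s.2 j)).

(* Expectation and variance under the uniform distribution on a finite type. *)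
Definition mean {R : realType} {T : finType} (f : T -> R) : R :=
  (\sum_(x : T) f x) / #|T|%:R.

Definition variance {R : realType} {T : finType} (f : T -> R) : R :=
  mean (fun x => (f x - mean f) ^+ 2).

Definition energy_variance {R : realType} {n m : nat} (W : 'M[R]_(n, m)) : R :=
  variance (energy W).

(* Main.v *)
Require Import Defs.
From mathcomp Require Import all_boot all_order all_algebra.
From mathcomp Require Import reals.
From mathcomp Require Import ring lra.

Import Order.TTheory GRing.Theory Num.Theory.
Local Open Scope ring_scope.

(** Under the uniform distribution the products [v_i h_j] are orthonormal and
    centered, so the variance of the energy is the sum of the squares of the
    weights.  An update with learning rate [gamma] therefore changes it by
    [2 gamma E0 + gamma^2 n m], a parabola in [gamma] with roots [0] and
    [- 2 E0 / (n m)]. *)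

Lemma eq_mean (R : realType) (T : finType) (f g : T -> R) :
  f =1 g -> mean f = mean g.
Proof. by move=> fg; congr (_ / _); apply: eq_bigr => x _. Qed.

Lemma mean_sum (R : realType) (T I : finType) (f : I -> T -> R) :
  mean (fun x => \sum_i f i x) = \sum_i mean (f i).
Proof. by rewrite /mean exchange_big mulr_suml. Qed.

Lemma meanZ (R : realType) (T : finType) (a : R) (f : T -> R) :
  mean (fun x => a * f x) = a * mean f.
Proof. by rewrite /mean -mulr_sumr mulrA. Qed.

(** The two coordinates of a uniformly distributed pair are independent. *)
Lemma mean_prod (R : realType) (T U : finType) (f : T -> R) (g : U -> R) :
  mean (fun x : T * U => f x.1 * g x.2) = mean f * mean g.
Proof.
rewrite /mean card_prod natrM invfM mulrACA; congr (_ * _).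
by rewrite big_distrlr /= pair_bigA.
Qed.

Lemma mean_cst (R : realType) (T : finType) (a : R) :
  (0 < #|T|)%N -> mean (fun _ : T => a) = a.
Proof.
move=> T_gt0; rewrite /mean sumr_const -[a *+ _]mulr_natr mulfK //.
by rewrite pnatr_eq0 -lt0n.
Qed.

(** An injective self-map of a finite type is a permutation, so reindexing by [g] shows that the sum
    equals its own opposite. *)
Lemma mean_odd (R : realType) (T : finType) (g : T -> T) (f : T -> R) :
  injective g -> (forall x, f (g x) = - f x) -> mean f = 0.
Proof.
move=> g_inj fg; rewrite /mean; suff -> : \sum_x f x = 0 by rewrite mul0r.
have : \sum_x f x = - \sum_x f x.
  by rewrite {1}(reindex_inj g_inj) -sumrN; apply: eq_bigr => x _.
by move=> /eqP; rewrite -addr_eq0 -mulr2n mulrn_eq0 => /eqP.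
Qed.

Lemma spinN (R : realType) (b : bool) : spin (~~ b) = - spin b :> R.
Proof. by case: b; rewrite /spin ?expr0 ?expr1 ?opprK. Qed.

Lemma spin_sqr (R : realType) (b : bool) : spin b * spin b = 1 :> R.
Proof. by case: b; rewrite /spin ?expr0 ?expr1 ?mulrNN mulr1. Qed.

(** Reversing one spin is the symmetry fed to [mean_odd]: it makes any product containing that spin
    exactly once average to zero. *)
Definition flip {n : nat} (i : 'I_n) (v : {ffun 'I_n -> bool}) :
    {ffun 'I_n -> bool} :=
  [ffun k => (k == i) (+) v k].

Lemma flip_inj (n : nat) (i : 'I_n) : injective (flip i).
Proof.
by apply: inv_inj => v; apply/ffunP => k; rewrite !ffunE addbA addbb.
Qed.

Lemma spin_flip (R : realType) (n : nat) (i k : 'I_n) v :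
  spin (flip i v k) = (if k == i then - spin (v k) else spin (v k)) :> R.
Proof. by rewrite ffunE; case: eqP => //= _; rewrite spinN. Qed.

Lemma mean_spin (R : realType) (n : nat) (i : 'I_n) :
  mean (fun v : {ffun 'I_n -> bool} => spin (v i)) = 0 :> R.
Proof.
by apply: (mean_odd _ _ (flip i)) (@flip_inj n i) _ => v; rewrite spin_flip eqxx.
Qed.

Lemma mean_spin_spin (R : realType) (n : nat) (i k : 'I_n) :
  mean (fun v : {ffun 'I_n -> bool} => spin (v i) * spin (v k))
  = (i == k)%:R :> R.
Proof.
have [<-|ik] := eqVneq i k.
  rewrite (eq_mean _ _ _ (fun=> 1)) => [|v]; last exact: spin_sqr.
  by rewrite mean_cst //; apply/card_gt0P; exists [ffun=> false].
(* As [k] differs from [i], the flip negates only the first factor. *)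
apply: (mean_odd _ _ (flip i)) (@flip_inj n i) _ => v.
by rewrite !spin_flip eqxx eq_sym (negPf ik) mulNr.
Qed.

(** These are characters of the sign group of all spin states; the energy is a linear combination of
    them, with the negated weights as coefficients. *)
Definition bond {R : realType} {n m : nat} (p : 'I_n * 'I_m)
    (s : spin_state n m) : R :=
  spin (s.1 p.1) * spin (s.2 p.2).

Lemma bond_sqr (R : realType) (n m : nat) (p : 'I_n * 'I_m) s :
  bond p s * bond p s = 1 :> R.
Proof. by rewrite /bond mulrACA !spin_sqr mulr1. Qed.

Lemma mean_bond (R : realType) (n m : nat) (p : 'I_n * 'I_m) :
  mean (bond p) = 0 :> R.
Proof.
rewrite (mean_prod _ _ _ (fun v : {ffun _} => spin (v p.1))
  (fun h : {ffun _} => spin (h p.2))).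
by rewrite mean_spin mul0r.
Qed.

(** Grouping visible spins with visible and hidden with hidden, independence of the layers leaves a
    product of two Kronecker deltas. *)
Lemma mean_bond_bond (R : realType) (n m : nat) (p q : 'I_n * 'I_m) :
  mean (fun s => bond p s * bond q s) = (p == q)%:R :> R.
Proof.
under eq_mean do rewrite /bond mulrACA.
rewrite (mean_prod _ _ _ (fun v : {ffun _} => spin (v p.1) * spin (v q.1))
  (fun h : {ffun _} => spin (h p.2) * spin (h q.2))).
by rewrite !mean_spin_spin -natrM mulnb.
Qed.

Lemma energyE (R : realType) (n m : nat) (W : 'M[R]_(n, m)) s :
  energy W s = \sum_p - W p.1 p.2 * bond p s.
Proof.
rewrite /energy pair_bigA -sumrN; apply: eq_bigr => p _.
by rewrite /bond mulNr mulrA.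
Qed.

Lemma mean_energy (R : realType) (n m : nat) (W : 'M[R]_(n, m)) :
  mean (energy W) = 0.
Proof.
rewrite (eq_mean _ _ _ _ (energyE _ _ _ W)) mean_sum big1 // => p _.
by rewrite meanZ mean_bond mulr0.
Qed.

(** This is Parseval's identity: the energy is centered, so its variance is its second moment, and
    orthonormality of the bonds leaves only the diagonal of the double sum. *)
Lemma energy_varianceE (R : realType) (n m : nat) (W : 'M[R]_(n, m)) :
  energy_variance W = \sum_p W p.1 p.2 ^+ 2.
Proof.
rewrite /energy_variance /variance mean_energy.
transitivity (mean (fun s : spin_state n m => \sum_p \sum_q
    (W p.1 p.2 * W q.1 q.2) * (bond p s * bond q s))).
  apply: eq_mean => s; rewrite subr0 energyE expr2 big_distrlr /=.
  by apply: eq_bigr => p _; apply: eq_bigr => q _; rewrite mulrACA mulrNN.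
rewrite mean_sum; apply: eq_bigr => p _; rewrite mean_sum (bigD1 p) //=.
rewrite meanZ mean_bond_bond eqxx mulr1 big1 ?addr0 // => q qp.
by rewrite meanZ mean_bond_bond eq_sym (negPf qp) mulr0.
Qed.

Lemma energy_variance_mode_update (R : realType) (n m : nat)
    (W : 'M[R]_(n, m)) (s : spin_state n m) (gamma : R) :
  energy_variance (mode_update W s gamma) =
  energy_variance W + 2 * gamma * energy W s + gamma ^+ 2 * (n%:R * m%:R).
Proof.
have -> : gamma ^+ 2 * (n%:R * m%:R) = \sum_(p : 'I_n * 'I_m) gamma ^+ 2.
  by rewrite sumr_const card_prod !card_ord -natrM mulr_natr.
rewrite !energy_varianceE energyE mulr_sumr -!big_split.
apply: eq_bigr => p _; rewrite mxE -mulrA -/(bond p s) /=.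
(* Writing the factor 1 as the squared bond makes the summand the plain expansion of the square of
   [W p.1 p.2 - gamma * bond p s]. *)
rewrite -[gamma ^+ 2]mulr1 -[X in gamma ^+ 2 * X](bond_sqr R n m p s).
by ring.
Qed.

Theorem theoremB3 (R : realType) (n m : nat) (n_ge1 : (1 <= n)%N)
    (m_ge1 : (1 <= m)%N) (W : 'M[R]_(n, m)) (s : spin_state n m)
    (W_gauged : gauged W s) :
  let E0 := energy W s in
  let decrease (gamma : R) :=
    energy_variance W - energy_variance (mode_update W s gamma) in
  let gamma_opt := - E0 / (n%:R * m%:R) in
  (forall gamma : R, 0 < gamma -> gamma < - (2 * E0) / (n%:R * m%:R) ->
     energy_variance (mode_update W s gamma) < energy_variance W) /\
  (forall gamma : R, gamma != gamma_opt -> decrease gamma < decrease gamma_opt).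
Proof.
move=> E0 decrease gamma_opt.
have N_gt0 : 0 < n%:R * m%:R :> R by rewrite mulr_gt0 ?ltr0n.
split=> gamma.
  move=> gamma_gt0; rewrite ltr_pdivlMr // => gamma_lt.
  rewrite energy_variance_mode_update -/E0 -addrA gtrDl.
  (* Factor the parabola at its root 0: the upper bound on [gamma] makes the other factor
     negative. *)
  have -> : 2 * gamma * E0 + gamma ^+ 2 * (n%:R * m%:R)
          = gamma * (2 * E0 + gamma * (n%:R * m%:R)) by ring.
  by rewrite pmulr_rlt0 //; lra.
move=> gamma_neq; rewrite -subr_gt0 /decrease !energy_variance_mode_update -/E0.
(* Expressing [E0] through the vertex [gamma_opt] prepares completing the square. *)
have -> : E0 = - (gamma_opt * (n%:R * m%:R)).
  by rewrite /gamma_opt divfK ?opprK // gt_eqF.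
set N := n%:R * m%:R in N_gt0 *.
(* With [x] the rate [gamma] and [y] the vertex, the optimal decrease exceeds the other by a square
   times [N]. *)
have -> : forall V x y : R, V - (V + 2 * y * - (y * N) + y ^+ 2 * N) -
    (V - (V + 2 * x * - (y * N) + x ^+ 2 * N)) = (x - y) ^+ 2 * N.
  by move=> V x y; ring.
by rewrite mulr_gt0 // exprn_even_gt0 //= subr_eq0.
Qed.
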